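(* For all sufficiently large $n \in \mathbb{N}$, $$\max_m f(n, m) - f(n, n) > \frac{0.36\, n \log n}{\log \log n},$$ where the maximum is over all positive integers $m$. In particular, if $n$ is sufficiently large, then there exists an interval of length $\frac{0.36\, n \log n}{\log \log n}$ that does not contain distinct multiples of $1, 2, \ldots, n$; that is, an interval $I$ of this length for which there do not exist $n$ pairwise distinct integers $a_1, \ldots, a_n \in I$ with $i \mid a_i$ for all $1 \le i \le n$.
   Context: For positive integers $n$ and $m$, $f(n,m)$ denotes the least integer such that the interval $(m, m + f(n,m)]$ contains $n$ distinct integers $a_1, a_2, \ldots, a_n$ such that $i$ divides $a_i$ for all $1 \le i \le n$. Here $\log$ is the natural logarithm. *)

(* Defs.v *)
From HB Require Import structures.
From mathcomp Require Import all_boot all_order all_algebra.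
From mathcomp Require Import all_classical all_reals all_analysis.
From mathcomp Require Import zify.
Set Implicit Arguments.
Unset Strict Implicit.
Unset Printing Implicit Defensive.
Import Order.TTheory GRing.Theory Num.Theory.
Local Open Scope classical_set_scope.
Local Open Scope ring_scope.

(* The integer attached to the divisor i.+1 is [a i], so that the divisors
   range over 1, ..., n when i ranges over 'I_n. *)
Definition has_distinct_multiples (n : nat) (A : set int) : Prop :=
  exists a : 'I_n -> int,
    [/\ injective a,
        forall i : 'I_n, ((i.+1)%:Z %| a i)%Z
      & forall i : 'I_n, A (a i)].

(* The least multiple of i.+1 exceeding m + i * n lies in
   (m + i * n, m + i.+1 * n], and these intervals are pairwise disjoint. *)
Lemma has_distinct_multiples_sqr (n m : nat) :
  has_distinct_multiples n [set` `]m%:Z, (m + n * n)%N%:Z] ].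
Proof.
pose b (i : nat) := (((m + i * n) %/ i.+1).+1 * i.+1)%N.
have bP (i : nat) : (i < n)%N -> (m + i * n < b i <= m + i.+1 * n)%N.
  move=> lt_in; rewrite /b.
  have := divn_eq (m + i * n) i.+1.
  have := ltn_pmod (m + i * n) (ltn0Sn i).
  move: (_ %/ _)%N (_ %% _)%N => q r lt_r eqm.
  by rewrite [(q.+1 * _)%N]mulSn [(i.+1 * n)%N]mulSn; lia.
have b_lt (i j : nat) : (i < n)%N -> (j < n)%N -> (i < j)%N -> (b i < b j)%N.
  move=> lin ljn lij; have /andP[_ hi] := bP i lin.
  have /andP[hj _] := bP j ljn.
  have : (i.+1 * n <= j * n)%N by rewrite leq_mul2r lij orbT.
  by lia.
exists (fun i : 'I_n => (b i)%:Z); split.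
- move=> i j /eqP; rewrite eqz_nat => /eqP eqb; apply/val_inj => /=.
  have [lij|lji|//] := ltngtP (val i) (val j).
    by have := b_lt i j (ltn_ord i) (ltn_ord j) lij; rewrite eqb ltnn.
  by have := b_lt j i (ltn_ord j) (ltn_ord i) lji; rewrite eqb ltnn.
- by move=> i; rewrite /b PoszM dvdz_mull.
- move=> i /=; rewrite in_itv /=.
  have /andP[h1 h2] := bP i (ltn_ord i).
  have : (i.+1 * n <= n * n)%N by rewrite leq_mul2r ltn_ord orbT.
  by move=> h; apply/andP; split; lia.
Qed.

Lemma f_subproof (n m : nat) :
  exists L : nat,
    `[< has_distinct_multiples n [set` `]m%:Z, (m + L)%N%:Z] ] >].
Proof. by exists (n * n)%N; apply/asboolP/has_distinct_multiples_sqr. Qed.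

Definition f (n m : nat) : nat := ex_minn (f_subproof n m).

Lemma fP (n m : nat) :
  has_distinct_multiples n [set` `]m%:Z, (m + f n m)%N%:Z] ] /\
  forall L : nat,
    has_distinct_multiples n [set` `]m%:Z, (m + L)%N%:Z] ] -> (f n m <= L)%N.
Proof.
rewrite /f; case: ex_minnP => k /asboolP hk kmin; split=> // L hL.
by apply: kmin; apply/asboolP.
Qed.

Lemma f_le_sqr (n m : nat) : (f n m <= n * n)%N.
Proof. by have [_] := fP n m; apply; exact: has_distinct_multiples_sqr. Qed.

Lemma max_f_subproof (n : nat) :
  exists M : nat, `[< exists2 m : nat, (0 < m)%N & f n m = M >].
Proof. by exists (f n 1); apply/asboolP; exists 1%N. Qed.

Lemma max_f_bound (n M : nat) :
  `[< exists2 m : nat, (0 < m)%N & f n m = M >] -> (M <= n * n)%N.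
Proof. by move=> /asboolP[m _ <-]; exact: f_le_sqr. Qed.

Definition max_f (n : nat) : nat :=
  ex_maxn (max_f_subproof n) (@max_f_bound n).

Lemma max_fP (n : nat) :
  (exists2 m : nat, (0 < m)%N & f n m = max_f n) /\
  forall m : nat, (0 < m)%N -> (f n m <= max_f n)%N.
Proof.
rewrite /max_f; case: ex_maxnP => k /asboolP hk kmax; split=> // m m0.
by apply: kmax; apply/asboolP; exists m.
Qed.

(* Main.v *)
Require Import Defs.
From mathcomp Require Import all_boot all_order all_algebra.
From mathcomp Require Import all_classical all_reals all_analysis.
From mathcomp Require Import zify ring lra.
Import Order.TTheory GRing.Theory Num.Theory.

Set Implicit Arguments.
Unset Strict Implicit.
Unset Printing Implicit Defensive.

(** The lower bound for the maximum of f(n, m) and the upper bound for f(n, n)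
    are proved separately: the first is about 0.42 n log n / loglog n, and the
    second is a small multiple of n log n / loglog n.

    Lower bound ([no_distinct_multiples]). By the Chinese remainder theorem
    an interval can be positioned so that the multiples of each prime p from
    a set S sit at prescribed residues. Let all p in S lie just below n / t
    for a fixed t, so that p has about c multiples in an interval of length
    c n / t, and write p in base E. If the multiples of p are placed at
      A - r(p) + h p  for h < c,  where  r(p) = sum_(1 <= i < c) (p mod E^i),
    then the h-th multiple does not depend on the digit of p of index
    c - 1 - h. So for each h the h-th multiples take at most
    n / E + E^(c-1) values altogether, and if S has more than
    c (n / E + E^(c-1)) elements, then there are fewer multiples than primes,
    and no choice of distinct multiples exists for the p in S, nor, after
    scaling the picture by t, for the numbers t p <= n. Chebyshev's estimate
    [many_primes] gives a set S with at least a constant times n / log n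
    elements, so E can be of the order of (log n)^2, and c is only limited by
    E^c <= n; this gives any c < (1/2) log n / loglog n. The value c = 0.45
    log n / loglog n is used, and t >= 16 costs a factor 16/17.

    Upper bound ([f_diag_small]). Let P be an integer with
    P^3 >= (2 log_2 n)^2. A number k with n / P < k <= n gets the multiple P k,
    in (n, P n]. A number k <= n / P gets a multiple k q in (P n, 8 P n] with q
    prime; there are at least 2 log_2 n such q because P n / k >= P^2, and
    a number N <= 8 P n is of the form k q for at most 2 log_2 n values of k,
    as q must be one of its prime divisors. Hall's theorem [hall_marriage]
    makes the choice injective. So f(n, n) <= 8 P n, and P may be as small as
    (log n)^(2/3) up to a constant. *)

(** * Primes between y and 8 y *)

Definition primes_in (y z : nat) : seq nat :=
  [seq p <- index_iota y.+1 z.+1 | prime p].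

Lemma mem_primes_in y z p : (p \in primes_in y z) = prime p && (y < p <= z).
Proof. by rewrite mem_filter mem_index_iota ltnS. Qed.

Lemma primes_in_uniq y z : uniq (primes_in y z).
Proof. exact/filter_uniq/iota_uniq. Qed.

Lemma coprime_prod_primes p (s : seq nat) :
  prime p -> p \notin s -> all prime s -> coprime p (\prod_(q <- s) q).
Proof.
move=> p_pr; elim: s => [|q s IHs] /=; first by rewrite big_nil coprimen1.
rewrite inE negb_or => /andP[neq_pq p_s] /andP[q_pr s_pr].
by rewrite big_cons coprimeMr IHs // andbT prime_coprime // dvdn_prime2.
Qed.

Lemma prod_dvdn_of_primes (s : seq nat) n :
  uniq s -> all prime s -> all (dvdn^~ n) s -> \prod_(p <- s) p %| n.
Proof.
elim: s => [|p s IHs] /=; first by rewrite big_nil dvd1n.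
case/andP=> p_s s_uniq /andP[p_pr s_pr] /andP[p_n s_n].
by rewrite big_cons Gauss_dvd ?p_n ?IHs // coprime_prod_primes.
Qed.

Lemma bin_mid_geq N : 2 ^ N <= 'C(N.*2, N).
Proof.
elim: N => // N IHN; rewrite doubleS expnS binS.
have h1 : 'C(N.*2, N) <= 'C(N.*2.+1, N.+1) by rewrite binS leq_addl.
have h2 : 'C(N.*2, N) <= 'C(N.*2.+1, N) by rewrite leq_bin2l.
by lia.
Qed.

(** The coefficient occurs twice in the row of sum 2^(2m+1). *)
Lemma bin_odd_leq m : 'C(m.*2.+1, m) <= 4 ^ m.
Proof.
have tot : \sum_(0 <= i < m.*2.+2) 'C(m.*2.+1, i) = 2 ^ m.*2.+1.
  rewrite -[2]/(1 + 1) expnDn big_mkord; apply: eq_bigr => i _.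
  by rewrite !exp1n !muln1.
have sym : 'C(m.*2.+1, m.+1) = 'C(m.*2.+1, m).
  by rewrite -[in RHS]bin_sub; [congr 'C(_, _); lia | lia].
have : 'C(m.*2.+1, m) + 'C(m.*2.+1, m.+1) <= 2 ^ m.*2.+1.
  rewrite -tot (@big_cat_nat _ _ _ m) //=; last by lia.
  rewrite (@big_ltn _ _ _ m); last by lia.
  rewrite (@big_ltn _ _ _ m.+1); last by lia.
  by lia.
by rewrite sym expnS -muln2 mulnC expnM -[2 ^ 2]/4 [X in X -> _]/=; lia.
Qed.

Lemma prime_dvd_fact p n : prime p -> p %| n`! -> p <= n.
Proof.
move=> p_pr; elim: n => [|n IHn]; first by rewrite fact0 (Euclid_dvd1 p_pr).
rewrite factS Euclid_dvdM // => /orP[/dvdn_leq-> //|/IHn]; exact: leqW.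
Qed.

(** Strong induction: for n = 2m + 1 the primes in (m + 1, n] all divide
    'C(2m + 1, m), which is at most 4^m; an even n > 2 adds no prime. *)
Lemma primorial_leq n : \prod_(p <- primes_in 0 n) p <= 4 ^ n.
Proof.
have step m z y : y <= m <= z ->
    \prod_(p <- primes_in y z) p =
    (\prod_(p <- primes_in y m) p) * \prod_(p <- primes_in m z) p.
  move=> /andP[ym mz]; rewrite !big_filter.
  by rewrite (@big_cat_nat _ _ _ m.+1).
elim/ltn_ind: n => n IHn.
have [n_small|n_gt2] := leqP n 2.
  by case: n n_small {IHn} => [|[|[|]]] //; rewrite unlock.
have [n_odd|n_even] := boolP (odd n); last first.
  have -> : primes_in 0 n = primes_in 0 n.-1.
    rewrite /primes_in -{1}(ltn_predK n_gt2) /index_iota !subn1 !succnK.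
    rewrite -(addn1 n.-1) iotaD filter_cat /= add1n (ltn_predK n_gt2).
    case: ifP => [/even_prime[n2|]|_]; [by rewrite n2 in n_gt2| |by rewrite cats0].
    by rewrite (negPf n_even).
  by apply: leq_trans (IHn n.-1 _) _; [lia | rewrite leq_exp2l //; lia].
pose m := n./2; have n_eq : n = m.*2.+1 by rewrite -[LHS]odd_double_half n_odd.
have m_gt0 : 0 < m by lia.
rewrite (step m.+1); last by lia.
apply: leq_trans (leq_mul (IHn m.+1 _) (_ : _ <= 4 ^ m)) _; first by lia.
- apply: leq_trans (bin_odd_leq m); apply: dvdn_leq.
    by rewrite bin_gt0; lia.
  apply: prod_dvdn_of_primes; rewrite ?primes_in_uniq //.
    by apply/allP => p; rewrite mem_primes_in => /andP[].
  apply/allP => p; rewrite mem_primes_in => /and3P[p_pr lt_mp le_pn] /=.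
  have : p %| n`! by rewrite dvdn_fact // prime_gt0.
  rewrite n_eq -(@bin_fact m.*2.+1 m); last by lia.
  rewrite Euclid_dvdM // Euclid_dvdM // => /or3P[] // /(prime_dvd_fact p_pr); lia.
- by rewrite -expnD n_eq leq_exp2l //; lia.
Qed.

Lemma sqrt_floor x : exists s, s ^ 2 <= x < s.+1 ^ 2.
Proof.
elim: x => [|x [s /andP[s_lo s_hi]]]; first by exists 0.
have [h|h] := leqP (s.+1 ^ 2) x.+1; [exists s.+1 | exists s].
  by rewrite h (leq_ltn_trans s_hi) // ltn_exp2r.
by rewrite h andbT leqW.
Qed.

(** In Legendre's formula for (2N)! / N!^2 each power p^i contributes at most 1,
    and it contributes 0 as soon as p^i > 2N. *)
Lemma logn_bin_leq p N :
  prime p -> 0 < N -> p ^ logn p 'C(N.*2, N) <= N.*2.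
Proof.
move=> p_pr N_gt0.
have p_gt1 := prime_gt1 p_pr.
have N_le : N <= N.*2 by lia.
pose k := trunc_log p N.*2.
suff : logn p 'C(N.*2, N) <= k.
  move=> v_le; apply: leq_trans (trunc_logP p_gt1 _); last by lia.
  by rewrite leq_exp2l.
have vE : logn p N.*2`! = logn p 'C(N.*2, N) + (logn p N`! + logn p N`!).
  rewrite -(bin_fact N_le) (_ : N.*2 - N = N); last by lia.
  by rewrite !lognM ?muln_gt0 ?fact_gt0 ?bin_gt0.
have widen : logn p N`! = \sum_(1 <= i < N.*2.+1) N %/ p ^ i.
  rewrite logn_fact // [RHS](@big_cat_nat _ _ _ N.+1) //=.
  rewrite [X in _ = _ + X]big1_seq ?addn0 // => i /=.
  rewrite mem_index_iota => /andP[lt_Ni _]; apply: divn_small.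
  exact: leq_trans lt_Ni (ltnW (ltn_expl _ _)).
have : logn p N.*2`! <= (logn p N`! + logn p N`!) + k; last by lia.
rewrite widen logn_fact // -big_split /=.
have -> : k = \sum_(1 <= i < N.*2.+1) (i <= k).
  rewrite (@big_cat_nat _ _ _ k.+1) //=; last first.
    have : p ^ k <= N.*2 by apply: trunc_logP => //; lia.
    by have := ltn_expl k p_gt1; lia.
  rewrite (eq_big_nat _ _ (F2 := fun=> 1)) => [|i /andP[_]]; last first.
    by rewrite ltnS => ->.
  rewrite [X in _ = _ + X]big1_seq => [|i /=].
    by rewrite sum_nat_const_nat addn0 muln1 subn1.
  by rewrite mem_index_iota => /andP[lt_ki _]; rewrite leqNgt lt_ki.
rewrite -big_split /=; apply: leq_sum => i _.
have [le_ik|lt_ki] := leqP i k; last first.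
  rewrite divn_small //; apply: leq_trans (trunc_log_ltn _ p_gt1) _.
  by rewrite leq_exp2l.
have pi_gt0 : 0 < p ^ i by rewrite expn_gt0 ltnW.
have := divn_eq N (p ^ i); have := ltn_pmod N pi_gt0.
move: (N %/ _) (N %% _) => q r lt_r N_eq.
have : N.*2 %/ p ^ i < q.*2 + 2; last by lia.
by rewrite ltn_divLR // N_eq; nia.
Qed.

Lemma prod_prime_powers n m : 0 < n -> (forall p, p \in primes n -> p < m) ->
  n = \prod_(1 <= p < m | prime p) p ^ logn p n.
Proof.
move=> n_gt0 small; rewrite {1}(prod_prime_decomp n_gt0) prime_decompE big_map /=.
have eq_p : perm_eq (primes n) [seq p <- index_iota 1 m | p \in primes n].
  apply: uniq_perm; rewrite ?primes_uniq ?filter_uniq ?iota_uniq // => p.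
  rewrite mem_filter mem_index_iota; have [p_n|//] := boolP (p \in _).
  by rewrite small // andbT; move: p_n; rewrite mem_primes => /andP[/prime_gt0].
rewrite (perm_big _ eq_p) big_filter big_mkcond [RHS]big_mkcond /=.
apply: eq_bigr => p _; have [|p_n] := ifPn.
  by rewrite mem_primes => /andP[->].
by case: ifP => // p_pr; move: p_n; rewrite -logn_gt0 lognE p_pr; case: (_ && _).
Qed.

Lemma prod_const_count (r : seq nat) (P : pred nat) x :
  \prod_(i <- r | P i) x = x ^ count P r.
Proof. by rewrite big_const_seq; elim: count => //= k ->; rewrite expnS. Qed.

Lemma count_leq_iota s m : count (fun p => p <= s) (index_iota 1 m) <= s.
Proof.
rewrite -size_filter -[X in _ <= X](size_iota 1); apply: uniq_leq_size.
  by rewrite filter_uniq ?iota_uniq.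
by move=> p; rewrite mem_filter !mem_index_iota mem_iota; lia.
Qed.

Lemma square_leq_exp2 b : 20 <= b -> 64 * b ^ 2 <= 2 ^ b.-1.
Proof.
elim: b => // b IHb; rewrite leq_eqVlt => /predU1P[<-|]; first by [].
rewrite ltnS => b_ge; apply: leq_trans (_ : 2 * 2 ^ b.-1 <= _); last first.
  by rewrite -expnS prednK //; lia.
apply: leq_trans (_ : 2 * (64 * b ^ 2) <= _); last by rewrite leq_mul2l IHb.
by rewrite -!mulnn; nia.
Qed.

Lemma trunc_log2_mul8 k y : 2 ^ k <= y -> k + 3 <= trunc_log 2 (8 * y).
Proof.
by move=> k_y; apply: trunc_log_max => //; rewrite addnC expnD leq_mul.
Qed.

(** Chebyshev's estimate, from the factorization of the central binomial
    coefficient 'C(8y, 4y) >= 2^(4y). The primes up to the square root of 8y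
    contribute a negligible factor, the other primes up to y occur with
    exponent at most 1 and contribute at most 4^y = 2^(2y), so the primes in
    (y, 8y] contribute at least 2^y, each of them at most 8y. *)
Lemma many_primes y : 2 ^ 16 <= y ->
  y <= (trunc_log 2 (8 * y)).+1 * size (primes_in y (8 * y)).
Proof.
move=> y_ge; set b := _.+1; set K := size _.
have [s /andP[s_lo s_hi]] := sqrt_floor (8 * y).
pose N := 4 * y; have N2 : N.*2 = 8 * y by rewrite /N; lia.
have y_gt0 : 0 < y by apply: leq_trans y_ge; rewrite expn_gt0.
have N_gt0 : 0 < N by rewrite /N; lia.
have y8_lt : 8 * y < 2 ^ b by exact: trunc_log_ltn.
have y8_gt0 : 0 < 8 * y by lia.
have b_ge : 20 <= b by rewrite ltnS; exact: (trunc_log2_mul8 y_ge).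
have bs_le : b * s <= y.
  have h := square_leq_exp2 b_ge; have := trunc_logP (isT : 1 < 2) y8_gt0.
  rewrite -[trunc_log _ _]/(b.-1) => h'.
  have h2 : 64 * b ^ 2 <= 8 * y by exact: leq_trans h'.
  have : (8 * (b * s)) ^ 2 <= (8 * y) ^ 2.
    have : 64 * b ^ 2 * s ^ 2 <= 8 * y * (8 * y) by apply: leq_mul.
    rewrite -[X in _ -> _ <= X]mulnn; apply: leq_trans.
    by rewrite !expnMn mulnA.
  by rewrite leq_exp2r // leq_pmul2l.
have key : 'C(N.*2, N) <= (8 * y) ^ s * 4 ^ y * (8 * y) ^ K.
  have small p : p \in primes 'C(N.*2, N) -> p < (8 * y).+1.
    rewrite ltnS -N2 => p_C; have p_pr : prime p.
      by move: p_C; rewrite mem_primes => /andP[].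
    have := logn_bin_leq p_pr N_gt0; apply: leq_trans.
    move: p_C; rewrite -logn_gt0 => v_gt0.
    by rewrite -{1}[p]expn1 leq_exp2l ?prime_gt1.
  rewrite (prod_prime_powers _ small); last by rewrite bin_gt0; lia.
  apply: (@leq_trans (\prod_(1 <= p < (8 * y).+1 | prime p)
     ((if p <= s then 8 * y else 1) * (if p <= y then p else 1) *
      (if y < p then 8 * y else 1)))).
    apply: leq_prod => p p_pr; have p_gt0 := prime_gt0 p_pr.
    have := logn_bin_leq p_pr N_gt0; rewrite N2 => v_le.
    have [le_ps|lt_sp] := leqP p s.
      apply: (leq_trans v_le); rewrite -mulnA leq_pmulr // muln_gt0.
      by case: ifP; case: ifP; rewrite ?p_gt0 ?y8_gt0.
    rewrite mul1n; have [le_py|lt_yp] := leqP p y; last by rewrite mul1n.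
    rewrite muln1 -[X in _ <= X]expn1 leq_exp2l ?prime_gt1 // leqNgt.
    apply/negP => v_gt1; have : p ^ 2 <= 8 * y.
      by apply: leq_trans v_le; exact: leq_pexp2l.
    by rewrite leqNgt => /negP; apply; apply: leq_trans s_hi _; rewrite leq_exp2r.
  rewrite !big_split /=; apply: leq_mul; first apply: leq_mul.
  - rewrite -big_mkcondr prod_const_count leq_pexp2l //.
    apply: leq_trans (count_leq_iota s (8 * y).+1); apply: sub_count => p /=.
    by case/andP.
  - apply: leq_trans (primorial_leq y); rewrite /primes_in big_filter -big_mkcondr.
    rewrite (@big_cat_nat _ _ _ y.+1) //=; last by lia.
    rewrite [X in _ * X]big1_seq ?muln1 => [|p]; last first.
      by rewrite mem_index_iota => /andP[/andP[_ le_py]]; rewrite ltnNge le_py.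
    rewrite big_mkcond [X in _ <= X]big_mkcond; apply: leq_prod => p _.
    by case: ifP => [/andP[-> _] //|_]; case: ifP => // /prime_gt0.
  - rewrite -big_mkcondr prod_const_count leq_pexp2l // /K size_filter.
    rewrite -[X in X <= _]size_filter -[X in _ <= X]size_filter.
    apply: uniq_leq_size; first by rewrite filter_uniq ?iota_uniq.
    by move=> p; rewrite !mem_filter !mem_index_iota; lia.
have : 2 ^ (4 * y) <= 2 ^ (b * s + 2 * y + b * K).
  apply: leq_trans (bin_mid_geq N) _; apply: leq_trans key _.
  have -> : 2 ^ (b * s + 2 * y + b * K) = (2 ^ b) ^ s * 4 ^ y * (2 ^ b) ^ K.
    by rewrite expnD expnD !(expnM 2).
  apply: leq_mul; first apply: leq_mul => //.
    by case: (s) => // s'; rewrite leq_exp2r // ltnW.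
  by case: (K) => // K'; rewrite leq_exp2r // ltnW.
by rewrite leq_exp2l //; lia.
Qed.

(** * Hall's marriage theorem *)

Section HallMarriage.
Import boot.fintype boot.finset.

(** Rado's argument: while some A i0 has two elements x and y, one of them can be
    deleted without breaking Hall's condition. Otherwise there are J and K with
    too few neighbours after deleting x, respectively y; both contain i0, and
    submodularity of the number of neighbours contradicts the condition for
    the union of J and K or for their intersection without i0. *)
Lemma hall_marriage (I T : finType) (A : I -> {set T}) :
  (forall J : {set I}, #|J| <= #|\bigcup_(i in J) A i|) ->
  exists2 g : I -> T, injective g & forall i, g i \in A i.
Proof.
have [m] := ubnP (\sum_i #|A i|); elim: m A => // m IHm A A_size hallA.
have [big|small] := boolP [exists i, 1 < #|A i|]; last first.
  have A1 i : #|A i| == 1.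
    rewrite eqn_leq; apply/andP; split.
      by rewrite leqNgt; apply: contra small => ?; apply/existsP; exists i.
    by have := hallA [set i]; rewrite cards1 big_set1.
  have [g gP] : exists g : I -> T, forall i, A i = [set g i].
    by apply: (@fin_all_exists _ _ (fun i z => A i = [set z])) => i; apply/cards1P.
  exists g => [i j eq_g|i]; last by rewrite gP set11.
  apply/eqP/negPn/negP => neq_ij; have := hallA [set i; j].
  by rewrite cards2 neq_ij bigcup_setU !big_set1 !gP eq_g setUid cards1.
have [i0 /card_gt1P[x [y [x_A y_A neq_xy]]]] := existsP big.
pose B z i := if i == i0 then A i0 :\ z else A i.
have B_sub z i : B z i \subset A i.
  by rewrite /B; case: eqP => // ->; exact: subD1set.
have shrink z : z \in A i0 ->
    (forall J : {set I}, #|J| <= #|\bigcup_(i in J) B z i|) ->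
    exists2 g : I -> T, injective g & forall i, g i \in A i.
  move=> z_A hallB; have [|//|g g_inj g_B] := IHm (B z).
    rewrite -ltnS; apply: leq_trans A_size; rewrite ltnS.
    rewrite (bigD1 i0) //= [X in _ < X](bigD1 i0) //= /B eqxx.
    rewrite [X in _ < X + _](cardsD1 z) z_A add1n ltnS leq_add2l.
    by apply: leq_sum => i /negPf->.
  by exists g => // i; apply: (subsetP (B_sub z i)).
have [/forallP|] := boolP [forall J : {set I}, #|J| <= #|\bigcup_(i in J) B x i|].
  exact: shrink.
rewrite negb_forall => /existsP[J]; rewrite -ltnNge => J_bad.
have [/forallP|] := boolP [forall J : {set I}, #|J| <= #|\bigcup_(i in J) B y i|].
  exact: shrink.
rewrite negb_forall => /existsP[K]; rewrite -ltnNge => K_bad.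
have mem_i0 z (L : {set I}) : #|\bigcup_(i in L) B z i| < #|L| -> i0 \in L.
  move=> L_bad; apply: contraLR L_bad => i0_L; rewrite -leqNgt.
  rewrite (eq_bigr A) // => i i_L; rewrite /B; case: eqP => // i_i0.
  by rewrite -i_i0 i_L in i0_L.
have J_i0 := mem_i0 _ _ J_bad; have K_i0 := mem_i0 _ _ K_bad.
move: J_bad K_bad; set U := \bigcup_(i in J) _; set V := \bigcup_(i in K) _.
move=> U_lt V_lt; have := cardsUI U V; have := cardsUI J K.
have UV_ge : #|J :|: K| <= #|U :|: V|.
  apply: leq_trans (hallA _) (subset_leq_card _).
  apply/bigcupsP => i; have [-> _|neq_i0] := eqVneq i i0.
    apply/subsetP => z z_A; rewrite inE.
    have [eq_zx|neq_zx] := eqVneq z x; apply/orP; [right | left].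
      by apply/bigcupP; exists i0 => //; rewrite /B eqxx !inE z_A eq_zx neq_xy.
    by apply/bigcupP; exists i0 => //; rewrite /B eqxx !inE z_A neq_zx.
  rewrite inE => /orP[i_J|i_K].
    by apply: subsetU; rewrite (bigcup_max i) // /B (negPf neq_i0).
  by apply: subsetU; rewrite orbC (bigcup_max i) // /B (negPf neq_i0).
have UIV_ge : #|(J :&: K) :\ i0| <= #|U :&: V|.
  apply: leq_trans (hallA _) (subset_leq_card _).
  apply/bigcupsP => i; rewrite !inE => /and3P[/negPf neq_i0 i_J i_K].
  by rewrite subsetI !(bigcup_max i) // /B neq_i0.
have := cardsD1 i0 (J :&: K); rewrite inE J_i0 K_i0 /=.
by lia.
Qed.

(** Double counting of the edges between J and its neighbours gives Hall's
    condition. *)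
Lemma hall_degree (I T : finType) (A : I -> {set T}) D :
  0 < D -> (forall i, D <= #|A i|) -> (forall x, #|[set i | x \in A i]| <= D) ->
  exists2 g : I -> T, injective g & forall i, g i \in A i.
Proof.
move=> D_gt0 degI degT; apply: hall_marriage => J.
rewrite -(leq_pmul2r D_gt0) -[X in X <= _]sum_nat_const.
apply: leq_trans (_ : \sum_(i in J) #|A i| <= _); first exact: leq_sum.
rewrite -[X in _ <= X]sum_nat_const.
have -> : \sum_(i in J) #|A i| =
    \sum_(i in J) \sum_(x in \bigcup_(i in J) A i) (x \in A i).
  apply: eq_bigr => i i_J; rewrite -sum1_card -big_mkcondr /=.
  apply: eq_bigl => x; have [x_A|] := boolP (x \in A i); rewrite ?andbF //.
  by rewrite andbT; apply/esym/bigcupP; exists i.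
rewrite exchange_big; apply: leq_sum => x _; apply: leq_trans (degT x).
rewrite -big_mkcondr sum1_card; apply: subset_leq_card.
by apply/subsetP => i; rewrite !inE => /andP[].
Qed.

End HallMarriage.

(** * The upper bound for f(n, n) *)

Section UpperBound.
Import boot.fintype boot.finset.

Lemma exp2_size_primes n : 0 < n -> 2 ^ size (primes n) <= n.
Proof.
move=> n_gt0; apply: leq_trans (_ : \prod_(p <- primes n) p <= _); last first.
  apply: dvdn_leq n_gt0 _; apply: prod_dvdn_of_primes; rewrite ?primes_uniq //.
    by apply/allP => p; rewrite mem_primes => /andP[].
  by apply/allP => p; rewrite mem_primes => /and3P[].
rewrite -[size _]count_predT -prod_const_count big_seq [X in _ <= X]big_seq.
by apply: leq_prod => p; rewrite mem_primes => /andP[/prime_gt1].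
Qed.

(** The index i stands for k = i + 1 <= n / P, whose candidates are the numbers
    k q with q a prime in (P n / k, 8 P n / k]. A number N is a candidate for at
    most D values of k, since N / k is then a prime divisor of N and
    2^(D+1) > N. *)
Lemma small_divisors_matched n P D :
  0 < D -> 0 < P -> 8 * P * n < 2 ^ D.+1 ->
  (forall y, P ^ 2 <= y -> D <= size (primes_in y (8 * y))) ->
  exists g : 'I_(n %/ P) -> nat,
    [/\ injective g, forall i : 'I_(n %/ P), i.+1 %| g i
      & forall i : 'I_(n %/ P), P * n < g i <= 8 * P * n].
Proof.
move=> D_gt0 P_gt0 n_lt dense.
pose y (i : 'I_(n %/ P)) := P * n %/ i.+1.
pose A (i : 'I_(n %/ P)) := [set N : 'I_(8 * P * n).+1 |
  has (fun q => N == i.+1 * q :> nat) (primes_in (y i) (8 * y i))].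
have range i q : q \in primes_in (y i) (8 * y i) ->
    [/\ prime q, P * n < i.+1 * q & i.+1 * q <= 8 * P * n].
  rewrite mem_primes_in => /and3P[q_pr lt_yq le_qy]; split=> //.
    by rewrite [X in _ < X]mulnC -ltn_divLR.
  apply: leq_trans (_ : i.+1 * (8 * y i) <= _); first by rewrite leq_mul2l.
  by rewrite mulnCA -mulnA leq_mul2l /= mulnC leq_trunc_div.
have [||g g_inj g_A] := @hall_degree _ _ A D D_gt0.
- move=> i; apply: leq_trans (dense (y i) _) _.
    rewrite /y leq_divRL // -mulnn -mulnA leq_mul2l; apply/orP; right.
    rewrite mulnC; apply: leq_trans (leq_trunc_div n P).
    by rewrite leq_mul2r ltn_ord orbT.
  rewrite cardE -(size_map (fun q => inord (i.+1 * q) : 'I_(8 * P * n).+1)).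
  apply: uniq_leq_size.
    rewrite map_inj_in_uniq ?primes_in_uniq // => q r /range[_ _ q_le].
    move=> /range[_ _ r_le] /(congr1 val) /=; rewrite !inordK ?ltnS // => /eqP.
    by rewrite eqn_pmul2l // => /eqP.
  move=> N /mapP[q q_in ->]; rewrite mem_enum inE; apply/hasP; exists q => //.
  by have [_ _ q_le] := range _ _ q_in; rewrite inordK.
- move=> x; have [x0|x_gt0] := posnP x.
    rewrite (_ : [set _ | _] = set0) ?cards0 //; apply/setP => i; rewrite !inE.
    apply/negbTE/hasPn => q /range[/prime_gt0 q_gt0 _ _]; rewrite x0.
    by rewrite eq_sym muln_eq0 /= -lt0n.
  have x_D : size (primes x) <= D.
    rewrite -ltnS -(@ltn_exp2l 2) //.
    apply: leq_ltn_trans (exp2_size_primes x_gt0) _.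
    by apply: leq_ltn_trans n_lt; rewrite -ltnS.
  apply: leq_trans x_D; rewrite cardE -(size_map (fun i : 'I__ => x %/ i.+1)).
  have quot i : i \in [set i | x \in A i] ->
      prime (x %/ i.+1) /\ x = i.+1 * (x %/ i.+1) :> nat.
    by rewrite !inE => /hasP[q /range[q_pr _ _] /eqP ->]; rewrite mulKn.
  apply: uniq_leq_size.
    rewrite map_inj_in_uniq ?enum_uniq // => i j; rewrite !mem_enum.
    move=> /quot[q_pr i_x] /quot[_ j_x] eq_q; apply/val_inj/succn_inj/eqP.
    by rewrite -(eqn_pmul2r (prime_gt0 q_pr)) -i_x {1}eq_q -j_x.
  move=> q /mapP[i]; rewrite mem_enum => /quot[q_pr i_x] ->.
  by rewrite mem_primes q_pr x_gt0 /= {2}i_x dvdn_mull.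
exists (fun i => nat_of_ord (g i)); split.
- by move=> i j /ord_inj /g_inj.
- by move=> i; have := g_A i; rewrite inE => /hasP[q _ /eqP->]; rewrite dvdn_mulr.
- move=> i; have := g_A i; rewrite inE => /hasP[q /range[_ lo hi] /eqP->].
  by rewrite lo.
Qed.

End UpperBound.

(** The multiples P k of the divisors k > n / P stay below P n, where the
    multiples found for the smaller divisors begin. *)
Lemma f_diag_leq n P D :
  0 < D -> 0 < P -> 8 * P * n < 2 ^ D.+1 ->
  (forall y, P ^ 2 <= y -> D <= size (primes_in y (8 * y))) ->
  f n n <= 8 * P * n.
Proof.
move=> D_gt0 P_gt0 n_lt dense.
have [g [g_inj g_dvd g_range]] := small_divisors_matched D_gt0 P_gt0 n_lt dense.
have [_] := fP n n; apply.
pose b (i : nat) :=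
  if insub i is Some j then g j else P * i.+1.
have b_small (i : nat) (hi : i < n %/ P) : b i = g (Ordinal hi).
  by rewrite /b insubT.
have b_big (i : nat) : n %/ P <= i -> b i = P * i.+1.
  by move=> hi; rewrite /b insubF // ltnNge hi.
have b_range (i : nat) : i < n -> n < b i <= 8 * P * n.
  move=> lt_in; have [hi|hi] := ltnP i (n %/ P).
    rewrite b_small; have /andP[lo ->] := g_range (Ordinal hi).
    by rewrite andbT; apply: leq_ltn_trans lo; rewrite leq_pmull.
  rewrite b_big //; apply/andP; split; first by rewrite mulnC -ltn_divLR.
  apply: leq_trans (_ : P * n <= _); first by rewrite leq_mul2l lt_in orbT.
  by rewrite -mulnA leq_pmull.
have b_split (i j : nat) :
    i < n -> j < n -> i < n %/ P -> n %/ P <= j -> b i <> b j.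
  move=> lt_in lt_jn hi hj; rewrite b_small (b_big j) // => eq_b.
  have /andP[] := g_range (Ordinal hi); rewrite eq_b ltn_mul2l => /andP[_].
  by rewrite ltnS leqNgt lt_jn.
exists (fun i : 'I_n => (b i)%:Z%R); split.
- move=> i j [] eq_b; apply/ord_inj.
  have [hi|hi] := ltnP i (n %/ P); have [hj|hj] := ltnP j (n %/ P).
  + by move: eq_b; rewrite !b_small => /g_inj[].
  + by case: (b_split _ _ (ltn_ord i) (ltn_ord j) hi hj).
  + by case: (b_split _ _ (ltn_ord j) (ltn_ord i) hj hi).
  + by move: eq_b; rewrite !b_big // => /eqP; rewrite eqn_pmul2l // => /eqP[].
- move=> i; rewrite dvdzE /=; have [hi|hi] := ltnP i (n %/ P).
    by rewrite b_small; exact: (g_dvd (Ordinal hi)).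
  by rewrite b_big // dvdn_mull.
- move=> i /=; rewrite in_itv /=; have /andP[lo hi] := b_range i (ltn_ord i).
  by rewrite ltz_nat lo lez_nat (leq_trans hi) // leq_addl.
Qed.

Lemma fourth_power_leq_exp2 b : 22 <= b -> b ^ 4 <= 2 ^ (b - 4).
Proof.
elim: b => // b IHb; rewrite leq_eqVlt => /predU1P[<-|].
  by rewrite (expnM 22 2 2) (expnM 2 9 2) leq_exp2r.
rewrite ltnS => b_ge; apply: leq_trans (_ : 2 * 2 ^ (b - 4) <= _); last first.
  by rewrite -expnS leq_exp2l //; lia.
apply: leq_trans (_ : 2 * b ^ 4 <= _); last by rewrite leq_mul2l IHb.
have h : 21 * b.+1 <= 22 * b by lia.
have : (21 * b.+1) ^ 4 <= (22 * b) ^ 4 by rewrite leq_exp2r.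
by rewrite !expnMn; move: (b ^ 4) (b.+1 ^ 4) => u v; lia.
Qed.

(** The logarithm in Chebyshev's estimate is at most the fourth root of y. *)
Lemma many_primes_power y : 2 ^ 18 <= y -> y ^ 3 <= size (primes_in y (8 * y)) ^ 4.
Proof.
move=> y_ge; have y_gt0 : 0 < y by apply: leq_trans y_ge; rewrite expn_gt0.
have y_ge' : 2 ^ 16 <= y by apply: leq_trans y_ge; rewrite leq_exp2l.
have := many_primes y_ge'; set b := _.+1; set K := size _ => y_le.
have b_ge : 22 <= b by rewrite ltnS; exact: (trunc_log2_mul8 y_ge).
have b4_le : b ^ 4 <= y.
  apply: leq_trans (fourth_power_leq_exp2 b_ge) _.
  rewrite -(@leq_pmul2l (2 ^ 3)) ?expn_gt0 // -expnD.
  rewrite (_ : 3 + (b - 4) = trunc_log 2 (8 * y)); last by lia.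
  by apply: trunc_logP => //; lia.
rewrite -(leq_pmul2l y_gt0) -expnS; apply: leq_trans (_ : (b * K) ^ 4 <= _).
  by rewrite leq_exp2r.
by rewrite expnMn leq_mul2r b4_le orbT.
Qed.

(** Every y >= P^2 has at least y^(3/4) >= P^(3/2) >= 2 log_2 n primes in
    (y, 8y], and 8 P n < 2^(2 log_2 n + 1). *)
Lemma f_diag_small n P : 2 ^ 9 <= P -> 8 * P <= trunc_log 2 n ->
  (2 * trunc_log 2 n) ^ 2 <= P ^ 3 -> f n n <= 8 * P * n.
Proof.
set l := trunc_log 2 n => P_ge P_le D_le.
have P_gt0 : 0 < P by apply: leq_trans P_ge; rewrite expn_gt0.
have l_gt0 : 0 < l by lia.
have l_lt := ltn_expl l (isT : 1 < 2).
apply: (@f_diag_leq n P (2 * l)); rewrite ?muln_gt0 //.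
  rewrite mul2n -addnn -addnS expnD; have := trunc_log_ltn n (isT : 1 < 2).
  rewrite -/l => n_lt; apply: leq_ltn_trans (_ : 2 ^ l * n < _).
    by rewrite leq_mul2r (leq_trans P_le (ltnW l_lt)) orbT.
  by rewrite ltn_mul2l expn_gt0.
move=> y y_ge; have y_big : 2 ^ 18 <= y.
  apply: leq_trans y_ge; rewrite (expnM 2 9 2) leq_exp2r //.
rewrite -(@leq_exp2r _ _ 4) //; apply: leq_trans (many_primes_power y_big).
apply: leq_trans (_ : (P ^ 2) ^ 3 <= _); last by rewrite leq_exp2r.
by rewrite (expnM _ 2 2) expnAC leq_exp2r.
Qed.

(** * An interval without distinct multiples *)

Definition offset (E c p : nat) : nat := \sum_(1 <= i < c) p %% E ^ i.

Definition drop_digit (E j p : nat) : nat := p %/ E ^ j.+1 * E ^ j + p %% E ^ j.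

(** Deleting a digit divides p by about E; the error comes from the incomplete
    leading block and is at most E^j <= E^(c-1). *)
Lemma drop_digit_lt E j c n p : 0 < E -> j < c -> p <= n ->
  drop_digit E j p < (n %/ E + E ^ c.-1).
Proof.
move=> E_gt0 lt_jc le_pn; have Ej_gt0 : 0 < E ^ j by rewrite expn_gt0 E_gt0.
apply: leq_trans (_ : p %/ E ^ j.+1 * E ^ j + E ^ j <= _).
  by rewrite ltn_add2l ltn_pmod.
apply: leq_add; last by apply: leq_pexp2l => //; lia.
apply: leq_trans (leq_div2r E le_pn).
by rewrite leq_divRL // -mulnA -expnSr leq_trunc_div.
Qed.

(** With h = c - 1 - j, this says that h p - offset E c p depends only on the
    digits of p of index other than j. Indeed offset E c p - h p is the sum of
    the p mod E^i with i <= j, which involve the digits below j only, and of the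
    h numbers p mod E^i - p = - E^i (p div E^i) with j < i < c, which involve the
    digits above j only. *)
Lemma offset_shift E c j p q : 0 < E -> j < c ->
  drop_digit E j p = drop_digit E j q ->
  offset E c p + (c - j.+1) * q = offset E c q + (c - j.+1) * p.
Proof.
move=> E_gt0 lt_jc; have Ej_gt0 : 0 < E ^ j by rewrite expn_gt0 E_gt0.
rewrite /drop_digit => eq_d.
have eq_mod : p %% E ^ j = q %% E ^ j.
  by have := congr1 (modn^~ (E ^ j)) eq_d; rewrite !modnMDl !modn_mod.
have eq_div : p %/ E ^ j.+1 = q %/ E ^ j.+1.
  have := congr1 (divn^~ (E ^ j)) eq_d.
  by rewrite !divnMDl // !(@divn_small (_ %% _)) ?ltn_pmod // !addn0.
have split_offset x y : offset E c x + (c - j.+1) * y =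
    \sum_(1 <= i < j.+1) x %% E ^ i + \sum_(j.+1 <= i < c) (x %% E ^ i + y).
  rewrite /offset (@big_cat_nat _ _ _ j.+1) //= big_split /=.
  by rewrite sum_nat_const_nat addnA.
rewrite !split_offset; congr (_ + _).
  apply: eq_big_nat => i /andP[_ le_ij].
  have Ei_j : E ^ i %| E ^ j by apply: dvdn_exp2l.
  by rewrite -(modn_dvdm p Ei_j) eq_mod modn_dvdm.
apply: eq_big_nat => i /andP[lt_ji _].
have Ei_split : E ^ i = E ^ j.+1 * E ^ (i - j.+1) by rewrite -expnD subnKC.
have eq_divi : p %/ E ^ i = q %/ E ^ i by rewrite Ei_split !divnMA eq_div.
have := divn_eq p (E ^ i); have := divn_eq q (E ^ i); rewrite eq_divi.
by clear; lia.
Qed.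

Lemma offset_leq E c p : 0 < E -> offset E c p <= c * E ^ c.
Proof.
move=> E_gt0; apply: leq_trans (_ : \sum_(1 <= i < c) E ^ c <= _).
  rewrite /offset big_nat [X in _ <= X]big_nat; apply: leq_sum => i /andP[_ lt_ic].
  apply: leq_trans (ltnW (ltn_pmod _ _)) _; first by rewrite expn_gt0 E_gt0.
  by apply: leq_pexp2l => //; exact: ltnW.
by rewrite sum_nat_const_nat leq_mul2r leq_subr orbT.
Qed.

(** Since solutions can be shifted by the product of the moduli, they can be
    taken above any bound B. *)
Lemma chinese_primes (s : seq nat) (r : nat -> nat) B :
  uniq s -> all prime s ->
  exists2 A, B <= A & forall p, p \in s -> A = r p %[mod p].
Proof.
elim: s B => [|p s IHs] B; first by exists B.
move=> /= /andP[p_s s_uniq] /andP[p_pr s_pr].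
have [A0 _ A0P] := IHs 0 s_uniq s_pr.
pose M := \prod_(q <- s) q.
have co_pM : coprime p M by exact: coprime_prod_primes.
have M_gt0 : 0 < M.
  by case: M co_pM => //; rewrite /coprime gcdn0 => /eqP p1; rewrite p1 in p_pr.
exists (chinese p M (r p) A0 + B * (p * M)).
  by rewrite (leq_trans _ (leq_addl _ _)) // leq_pmulr // muln_gt0 prime_gt0.
move=> q; rewrite inE => /predU1P[->|q_s].
  by rewrite mulnCA mulnC addnC modnMDl chinese_modl.
have q_M : q %| M by rewrite /M (big_rem q) //= dvdn_mulr.
rewrite mulnA addnC -(modn_dvdm _ q_M) modnMDl chinese_modr // modn_dvdm //.
exact: A0P.
Qed.

Lemma has_distinct_multiples_nat n m l :
  has_distinct_multiples n [set` `]m%:Z, (m + l)%N%:Z]%R ]%classic ->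
  exists b : nat -> nat,
    [/\ {in [pred d | 0 < d <= n] &, injective b},
        forall d, 0 < d <= n -> d %| b d
      & forall d, 0 < d <= n -> m < b d <= m + l].
Proof.
case=> a [a_inj a_dvd a_in].
pose b d := if insub d.-1 is Some i then `|a i|%N else 0.
have bE (i : 'I_n) : Posz (b i.+1) = a i /\ m < b i.+1 <= m + l.
  rewrite /b /= valK; have := a_in i; rewrite /= in_itv /=.
  by case: (a i) => k //=; rewrite ltz_nat lez_nat.
have ordE d : 0 < d <= n -> exists i : 'I_n, d = i.+1.
  by case: d => // d /= lt_dn; exists (Ordinal lt_dn).
exists b; split.
- move=> d d' /ordE[i ->] /ordE[j ->] eq_b; congr (_.+1).
  congr (nat_of_ord _); apply: a_inj.
  by have [<- _] := bE i; have [<- _] := bE j; rewrite eq_b.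
- by move=> d /ordE[i ->]; have := a_dvd i; have [<- _] := bE i; rewrite dvdzE.
- by move=> d /ordE[i ->]; have [] := bE i.
Qed.

(** With A = offset E c p modulo every p in s, the multiples of p are the
    numbers A - offset E c p + h p. As q <= p and offset E c p <= c E^c, those in
    the interval from A - q to A + c q - c E^c - 1 have 0 <= h < c, and by
    [offset_shift] the pair of h and the truncated p determines the multiple.
    There are fewer such pairs than elements of s. Everything is multiplied by
    t, so that the divisors are the numbers t p <= n. *)
Lemma no_distinct_multiples n t c E :
  0 < E -> 0 < c -> 0 < t ->
  let s := [seq p <- primes_in 0 n | n %/ p == t] in
  let q := (n %/ t.+1).+1 in
  c * (n %/ E + E ^ c.-1) < size s ->
  c * E ^ c < q ->
  exists2 m : nat, 0 < m & ~ has_distinct_multiples n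
    [set` `]m%:Z, (m + t * (c.+1 * q - c * E ^ c - 1))%N%:Z]%R ]%classic.
Proof.
move=> E_gt0 c_gt0 t_gt0 s q s_big R_small.
set R := c * E ^ c in R_small *; set L := c.+1 * q - R - 1.
have sP p : p \in s -> [/\ prime p, q <= p & t * p <= n].
  rewrite mem_filter mem_primes_in => /andP[/eqP n_p /and3P[p_pr p_gt0 _]].
  split=> //; last by rewrite -n_p leq_trunc_div.
  by rewrite ltn_divLR // -n_p mulnC ltn_ceil.
have s_uniq : uniq s by rewrite filter_uniq ?primes_in_uniq.
have s_pr : all prime s by apply/allP => p /sP[].
have [A A_big AP] := chinese_primes (offset E c) q.+1 s_uniq s_pr.
pose B := A - q; exists (t * B); first by rewrite muln_gt0 t_gt0 subn_gt0.
case/has_distinct_multiples_nat => b [b_inj b_dvd b_in].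
(* b (t * p) is the h p-th multiple of t * p, counted from t (A - offset E c p) *)
pose h p := b (t * p) %/ (t * p) - (A - offset E c p) %/ p.
have off_le p : offset E c p <= R by exact: offset_leq.
have divisor p : p \in s -> 0 < t * p <= n.
  by case/sP => /prime_gt0 p_gt0 _ ->; rewrite muln_gt0 t_gt0 p_gt0.
have pos p : p \in s ->
    h p < c /\ b (t * p) = t * (A - offset E c p + h p * p).
  move=> p_s; have [p_pr le_qp _] := sP p p_s; have p_gt0 := prime_gt0 p_pr.
  have tp_n := divisor p p_s; have /andP[tp_gt0 _] := tp_n.
  have off_lt := off_le p.
  have : p %| A - offset E c p.
    by rewrite -eqn_mod_dvd; [apply/eqP; exact: AP | lia].
  have /dvdnP[k b_eq] := b_dvd _ tp_n; have := b_in _ tp_n.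
  rewrite /h b_eq mulnK // mulnCA ltn_pmul2l // -mulnDr leq_pmul2l //.
  move=> /andP[lo hi] /dvdnP[u off_eq]; rewrite off_eq mulnK //.
  have le_uk : u <= k.
    rewrite leqNgt; apply/negP => lt_ku.
    have : k.+1 * p <= u * p by rewrite leq_mul2r lt_ku orbT.
    by rewrite mulSn; rewrite /B in lo; lia.
  split; last by rewrite -mulnDl subnKC.
  rewrite ltnNge; apply/negP => le_ch.
  have : (c + u) * p <= k * p by rewrite leq_mul2r; lia.
  have : c * q <= c * p by rewrite leq_mul2l le_qp orbT.
  have : q <= c * q by rewrite leq_pmull.
  by move: hi; rewrite /L /B mulnDl mulSn; lia.
pose M := n %/ E + E ^ c.-1.
(* the pair of h p and of the truncated p, encoded as a number below c M *)
pose code p := h p * M + drop_digit E (c - (h p).+1) p.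
have drop_lt p : p \in s -> drop_digit E (c - (h p).+1) p < M.
  move=> p_s; have [h_lt _] := pos p p_s; apply: drop_digit_lt => //; first by lia.
  by have [/prime_gt0 p_gt0 _] := sP p p_s; apply: leq_trans; rewrite leq_pmull.
have M_gt0 : 0 < M by rewrite addn_gt0 !expn_gt0 E_gt0 orbT.
move: s_big; rewrite ltnNge => /negP; apply; rewrite -/M.
rewrite -(size_iota 0 (c * M)) -(size_map code); apply: uniq_leq_size.
  rewrite map_inj_in_uniq // => p p' p_s p'_s eq_code.
  have [h_lt b_p] := pos p p_s; have [h'_lt b_p'] := pos p' p'_s.
  have eq_h : h p = h p'.
    have := congr1 (divn^~ M) eq_code.
    by rewrite /code !divnMDl // !(divn_small (drop_lt _ _)) // !addn0.
  have eq_d : drop_digit E (c - (h p).+1) p = drop_digit E (c - (h p).+1) p'.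
    by move: eq_code; rewrite /code -eq_h => /addnI.
  have lt_jc : c - (h p).+1 < c by clear - c_gt0; lia.
  have := offset_shift E_gt0 lt_jc eq_d.
  rewrite (_ : c - (c - (h p).+1).+1 = h p) => [shift|].
    2: by clear - h_lt; lia.
  have : t * p = t * p'.
    apply: b_inj; [exact: divisor | exact: divisor | rewrite b_p b_p' -eq_h].
    congr (_ * _); have := off_le p; have := off_le p'.
    by clear - shift R_small A_big; lia.
  by move/eqP; rewrite eqn_pmul2l // => /eqP.
move=> x /mapP[p p_s ->]; have [h_lt _] := pos p p_s.
rewrite mem_iota /= /code; apply: leq_trans (_ : (h p).+1 * M <= _).
  by rewrite mulSn addnC ltn_add2r drop_lt.
by rewrite leq_mul2r h_lt orbT.
Qed.

(** The quotient n / p of a prime p in (y, 8y], with y = n / (8T), lies in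
    [T, 8T), and one of these 7T values is taken by many p. *)
Lemma primes_window n T : 0 < T -> 2 ^ 16 <= n %/ (8 * T) ->
  exists2 t, T <= t < 8 * T &
    n %/ (8 * T) <= (trunc_log 2 n).+1 *
      (7 * T * size [seq p <- primes_in 0 n | n %/ p == t]).
Proof.
move=> T_gt0; set y := n %/ _ => y_ge.
have y_gt0 : 0 < y by apply: leq_trans y_ge; rewrite expn_gt0.
have y_n : y * (8 * T) <= n by exact: leq_trunc_div.
pose s t := [seq p <- primes_in 0 n | n %/ p == t].
pose S := size (primes_in y (8 * y)).
have y_S : y <= (trunc_log 2 n).+1 * S.
  apply: leq_trans (many_primes y_ge) _; rewrite leq_mul2r ltnS.
  by rewrite leq_trunc_log ?orbT //; nia.
have S_sum : S <= \sum_(T <= t < 8 * T) size (s t).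
  have -> : \sum_(T <= t < 8 * T) size (s t) =
      size (flatten [seq s t | t <- index_iota T (8 * T)]).
    by rewrite size_flatten /shape -map_comp sumnE big_map.
  apply: uniq_leq_size; first exact: primes_in_uniq.
  move=> p; rewrite mem_primes_in => /and3P[p_pr lt_yp le_p8y].
  have p_gt0 := prime_gt0 p_pr.
  apply/flatten_mapP; exists (n %/ p); rewrite ?mem_index_iota.
    rewrite leq_divRL // ltn_divLR //; apply/andP; split; first by nia.
    by rewrite mulnC -ltn_divLR //; lia.
  rewrite mem_filter eqxx mem_primes_in p_pr p_gt0 /=; nia.
have [/hasP[t]|/hasPn small] := boolP (has (fun t => S <= 7 * T * size (s t))
                                           (index_iota T (8 * T))).
  rewrite mem_index_iota => t_range S_t; exists t => //.
  by apply: leq_trans y_S _; rewrite leq_mul2l S_t orbT.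
have : \sum_(T <= t < 8 * T) 7 * T * size (s t) <= \sum_(T <= t < 8 * T) S.-1.
  rewrite big_nat [X in _ <= X]big_nat; apply: leq_sum => t t_range.
  have := small t; rewrite mem_index_iota -ltnNge => /(_ t_range); lia.
rewrite -big_distrr sum_nat_const_nat /= (_ : 8 * T - T = 7 * T); last by lia.
rewrite leq_pmul2l ?muln_gt0 //.
have S_gt0 : 0 < S by case: S y_S {S_sum small} => //; rewrite muln0; lia.
by lia.
Qed.

(** The choice E = l^2 and T = 16 in the lemmas above. With t >= 16 and
    q > n / (t + 1), the length t (c + 1) q is at least (16/17) (c + 1) n, and
    the terms with c E^c cost at most n / 100. The constants are written as
    products because large numerals of type nat are unwieldy. *)
Lemma long_bad_interval n c :
  let l := trunc_log 2 n in
  0 < c -> 2 ^ 16 <= n %/ 128 -> 512 * (256 * c) <= l ->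
  256 * (100 * (c * (l ^ 2) ^ c)) <= n ->
  exists len m : nat, [/\ 0 < m, 1600 * (c.+1 * n) <= 1700 * len + 17 * n &
    ~ has_distinct_multiples n [set` `]m%:Z, (m + len)%N%:Z]%R ]%classic].
Proof.
move=> l c_gt0 n_big c_l E_n.
have l_gt0 : 0 < l by lia.
pose E := l ^ 2; have E_gt0 : 0 < E by rewrite expn_gt0 l_gt0.
have [t /andP[t_ge t_lt]] := @primes_window n 16 isT n_big.
rewrite -/l -[8 * 16]/128; set s := [seq _ <- _ | _] => s_big.
set q := (n %/ t.+1).+1.
have n_div : n < (n %/ 128).+1 * 128 by exact: ltn_ceil.
have cE_q : c * E ^ c < q.
  rewrite ltnS leq_divRL //; move: E_n; rewrite -/E; move: (c * E ^ c) => w; nia.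
have s_gt : c * (n %/ E + E ^ c.-1) < size s.
  have Ec_n : E ^ c.-1 <= n %/ E.
    rewrite leq_divRL // -expnSr prednK //; apply: leq_trans E_n.
    by rewrite -/E; move: (E ^ c) => w; nia.
  have QE : n %/ E * (l * l) <= n.
    by rewrite mulnn leq_trunc_div.
  rewrite ltnNge; apply/negP => s_le.
  have s_le2 : size s <= 2 * (c * (n %/ E)).
    apply: leq_trans s_le _.
    by rewrite mulnCA leq_mul2l mul2n -addnn leq_add2l Ec_n orbT.
  have h : (l.+1) * (7 * 16 * size s) <= 448 * (c * l * (n %/ E)).
    by move: (n %/ E) s_le2 => Q; move: (size s) => z; nia.
  have h2 : 512 * (256 * (c * l * (n %/ E))) <= n.
    by apply: leq_trans QE; move: (n %/ E) => Q; nia.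
  move: s_big h h2 n_div n_big; move: (2 ^ 16) (expn_gt0 2 16) => z z0.
  by move: (n %/ 128) (c * l * (n %/ E)) (l.+1 * _) => a b d; lia.
have t_gt0 : 0 < t by exact: leq_trans t_ge.
have [m m_gt0 bad] := no_distinct_multiples E_gt0 c_gt0 t_gt0 s_gt cE_q.
exists (t * (c.+1 * q - c * E ^ c - 1)), m; split=> //.
have : 0 < c * E ^ c by rewrite muln_gt0 c_gt0 expn_gt0 E_gt0.
move: E_n cE_q; rewrite -/E; move: (c * E ^ c) => w w_n w_q w_gt0.
have n_q : n < q * t.+1 by exact: ltn_ceil.
have : 16 * (c.+1 * n) <= 17 * (t * (c.+1 * q)).
  have : 16 * n <= 17 * (t * q) by clear - n_q t_ge; nia.
  by move: (c.+1) => k; clear; nia.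
have : t * (c.+1 * q) <= t * (c.+1 * q - w - 1) + t * w.+1.
  by rewrite -mulnDr leq_mul2l; lia.
have : t * w.+1 <= 128 * w.+1 by rewrite leq_mul2r (ltnW t_lt) orbT.
have : 100 * (128 * w.+1) <= n by lia.
by move: (t * _) (t * w.+1) (t * (c.+1 * q)) (c.+1 * n) => a b d e; lia.
Qed.

(** * Choice of the parameters *)

Local Open Scope classical_set_scope.
Local Open Scope ring_scope.

Lemma loglog_unbounded (R : realType) (B : R) :
  exists N : nat, forall n : nat, (N <= n)%N -> B <= ln (ln n%:R).
Proof.
exists (Num.truncn (expR (expR B))).+1 => n n_ge.
have /andP[_ lt_n] := truncn_itv (ltW (expR_gt0 (expR B))).
have {}lt_n : expR (expR B) < n%:R.
  by apply: lt_le_trans lt_n _; rewrite ler_nat.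
have n_gt0 : 0 < n%:R :> R by apply: lt_trans (expR_gt0 _) lt_n.
have lt_ln : expR B < ln n%:R by rewrite -ltr_expR lnK ?posrE.
have ln_gt0 : 0 < ln n%:R :> R by apply: lt_trans (expR_gt0 _) lt_ln.
by rewrite -ler_expR lnK ?posrE // ltW.
Qed.

(** From the term x^6 / 6! of the exponential series. *)
Lemma cube_leq_expR (R : realType) (x : R) :
  10 ^+ 6 <= x -> 10 ^+ 15 * x ^+ 3 <= expR x.
Proof.
move=> x_ge; have x_ge0 : 0 <= x by apply: le_trans x_ge; rewrite exprn_ge0.
apply: le_trans (expR_ge1Dxn 5 x_ge0); rewrite ler_wpDl //.
have fact6 : (6`!)%:R <= 10 ^+ 3 :> R by rewrite -natrX ler_nat.
have fact_gt0 : 0 < (6`!)%:R :> R by rewrite ltr0n.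
have x3_ge0 : 0 <= x ^+ 3 by rewrite exprn_ge0.
rewrite ler_pdivlMr //; apply: le_trans (_ : 10 ^+ 15 * x ^+ 3 * 10 ^+ 3 <= _).
  by rewrite ler_wpM2l // mulr_ge0 // exprn_ge0.
rewrite (_ : 10 ^+ 15 * x ^+ 3 * 10 ^+ 3 = x ^+ 3 * (10 ^+ 6) ^+ 3); last first.
  by rewrite mulrAC -exprD -exprM mulrC.
rewrite (exprD x 3 3) ler_wpM2l // lerXn2r ?nnegrE // exprn_ge0 //.
Qed.

Lemma trunc_log2_bounds (R : realType) n : (0 < n)%N ->
  ln n%:R - 1 <= (trunc_log 2 n)%:R :> R /\ (trunc_log 2 n)%:R <= 2 * ln n%:R :> R.
Proof.
move=> n_gt0; set l := trunc_log 2 n.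
have nR_gt0 : 0 < n%:R :> R by rewrite ltr0n.
have ln2_le : ln 2 <= 1 :> R.
  by rewrite -ler_expR lnK ?posrE //; have := expR_ge1Dx (1 : R); lra.
have ln2_ge : 1 / 2 <= ln 2 :> R.
  rewrite -ler_expR lnK ?posrE //.
  have := expR_ge1Dx (- (1 / 2) : R); rewrite expRN.
  have := expR_gt0 (1 / 2 : R); set e := expR _ => e_gt0 h.
  rewrite -[e]invrK -[2]invrK lef_pV2 ?posrE ?invr_gt0 //; lra.
have l_ge0 : 0 <= l%:R :> R by [].
have lnX k : ln (2 ^ k)%N%:R = k%:R * ln 2 :> R.
  by rewrite natrX lnXn // mulr_natl.
split.
  have : ln n%:R <= ln (2 ^ l.+1)%N%:R :> R.
    rewrite ler_ln ?posrE ?ltr0n ?expn_gt0 // ler_nat ltnW //.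
    exact: trunc_log_ltn.
  by rewrite lnX -(addn1 l) natrD; nra.
have : ln (2 ^ l)%N%:R <= ln n%:R :> R.
  by rewrite ler_ln ?posrE ?ltr0n ?expn_gt0 // ler_nat trunc_logP.
by rewrite lnX; nra.
Qed.

(** Here x = loglog n, so that log n = expR x = u x with u = log n / loglog n, and
    l stands for log_2 n. The decisive bound is
    (l^2)^c <= expR (2 c (x + 1)) <= expR (0.9 u (x + 1)) <= expR (0.95 log n),
    which leaves a factor expR (0.05 log n) for the constants; the bound
    (2 l)^2 <= P^3 holds because u is much larger than x^2. *)
Lemma parameters (R : realType) (x u : R) (n l c P : nat) :
  10 ^+ 6 <= x -> expR (u * x) = n%:R -> expR x = u * x ->
  u * x - 1 <= l%:R -> l%:R <= 2 * (u * x) ->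
  (2 ^ l <= n)%N ->
  c%:R <= 45 / 100 * u < c.+1%:R -> P%:R <= 3 / 1000 * u < P.+1%:R ->
  [/\ [/\ (0 < c)%N, (2 ^ 16 <= n %/ 128)%N, (512 * (256 * c) <= l)%N &
         (256 * (100 * (c * (l ^ 2) ^ c)) <= n)%N],
      [/\ (2 ^ 9 <= P)%N, (8 * P <= l)%N & ((2 * l) ^ 2 <= P ^ 3)%N] & 1000 <= u].
Proof.
move=> x_ge n_eq L_eq l_ge l_le n_ge /andP[c_le c_gt] /andP[P_le P_gt].
have := cube_leq_expR x_ge; rewrite L_eq => L_ge.
have x_ge1 : 1000 * 1000 <= x by move: x_ge; clear; lra.
have x_gt0 : 0 < x by move: x_ge1; clear; lra.
have K_ge : 10 * (1000 * (1000 * 1000)) <= 10 ^+ 15 :> R by clear; lra.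
have u_ge : 10 * (1000 * (1000 * 1000)) * x ^+ 2 <= u.
  set K := _ * (_ * _) in K_ge *.
  rewrite -(ler_pM2r x_gt0) -mulrA -exprSr; apply: le_trans L_ge.
  by rewrite ler_wpM2r // exprn_ge0 // ltW.
have {K_ge L_ge x_ge} u_big1 : 1000 * (1000 * 1000) <= u.
  apply: le_trans u_ge; have : 1 <= x ^+ 2 by apply: exprn_ege1; clear - x_ge1; lra.
  by clear; lra.
rewrite -(addn1 c) natrD in c_gt; rewrite -(addn1 P) natrD in P_gt.
have ux_ge : 1000 * 1000 * u <= u * x.
  by rewrite mulrC ler_wpM2l //; clear - u_big1; lra.
have P_ge : 2 / 1000 * u <= P%:R by clear - P_gt u_big1; lra.
split; last by clear - u_big1; lra.
  split.
  - by rewrite -(ltr0n R); clear - c_gt u_big1; lra.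
  - rewrite leq_divRL //; apply: leq_trans n_ge.
    rewrite -[128%N]/(2 ^ 7)%N -expnD leq_exp2l //.
    by rewrite -(ler_nat R); clear - u_big1 ux_ge l_ge; lra.
  - rewrite -(ler_nat R) (natrM R 512) (natrM R 256).
    by clear - u_big1 ux_ge l_ge c_le; lra.
  - rewrite -(ler_nat R) (natrM R 256) (natrM R 100) natrM -expnM natrX -n_eq.
    have l_exp : l%:R <= expR (x + 1).
      apply: le_trans l_le _; rewrite expRD L_eq mulrC ler_wpM2l //.
        by clear - u_big1 ux_ge; lra.
      by have := expR_ge1Dx (1 : R); clear; lra.
    have pow_le : l%:R ^+ (2 * c) <= expR (95 / 100 * (u * x)).
      apply: le_trans (_ : expR ((x + 1) * (2 * c)%:R) <= _).
        by rewrite expRM_natr lerXn2r ?nnegrE ?expR_ge0 ?ler0n.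
      rewrite ler_expR natrM.
      have : (x + 1) * c%:R <= (x + 1) * (45 / 100 * u).
        by rewrite ler_wpM2l //; clear - x_gt0; lra.
      by clear - u_big1 ux_ge x_ge1; lra.
    have lin_le : 256 * 100 * c%:R <= expR (5 / 100 * (u * x)).
      have y_ge0 : 0 <= 5 / 100 * (u * x) by clear - u_big1 ux_ge; lra.
      apply: le_trans (expR_ge1Dxn 1 y_ge0).
      have : u * x * (1000 * 1000) <= u * x * (u * x).
        by rewrite ler_wpM2l //; clear - u_big1 ux_ge; lra.
      rewrite [_ ^+ 2]expr2 (_ : 2`! = 2)%N //.
      by clear - u_big1 ux_ge c_le; lra.
    rewrite !mulrA (_ : u * x = 5 / 100 * (u * x) + 95 / 100 * (u * x)).
    2: by clear; lra.
    rewrite expRD; apply: ler_pM lin_le pow_le; last exact: exprn_ge0.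
    by have := ler0n R c; clear; lra.
split.
- by rewrite -(ler_nat R) natrX; clear - P_ge u_big1; lra.
- by rewrite -(ler_nat R) natrM; clear - P_le l_ge ux_ge u_big1; lra.
- rewrite -(ler_nat R) !natrX natrM.
  apply: le_trans (_ : (4 * (u * x)) ^+ 2 <= _).
    by apply: lerXn2r; rewrite ?nnegrE; clear - l_le l_ge u_big1 ux_ge; lra.
  apply: le_trans (_ : (2 / 1000 * u) ^+ 3 <= _); last first.
    by apply: lerXn2r; rewrite ?nnegrE; clear - P_ge u_big1; lra.
  rewrite (_ : (4 * (u * x)) ^+ 2 = u ^+ 2 * (16 * x ^+ 2)); last by ring.
  rewrite (_ : (2 / 1000 * u) ^+ 3 = u ^+ 2 * ((2 / 1000) ^+ 3 * u)); last by ring.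
  have x2_ge0 : 0 <= x ^+ 2 by rewrite exprn_ge0 // ltW.
  by rewrite ler_wpM2l ?exprn_ge0 //; clear - u_ge u_big1 x2_ge0; lra.
Qed.

(** * The gap between the maximum and f(n, n) *)

Lemma has_distinct_multiples_sub n (A B : set int) :
  A `<=` B -> has_distinct_multiples n A -> has_distinct_multiples n B.
Proof. by move=> AB [a [inj dvd mem]]; exists a; split=> // i; apply: AB. Qed.

Lemma ltn_f n m len :
  ~ has_distinct_multiples n [set` `]m%:Z, (m + len)%N%:Z] ] -> (len < f n m)%N.
Proof.
move=> bad; rewrite ltnNge; apply/negP => f_le; apply: bad.
apply: has_distinct_multiples_sub (fP n m).1 => z /=; rewrite !in_itv /=.
by case/andP=> -> /le_trans -> //; rewrite lez_nat leq_add2l.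
Qed.

Theorem theorem1 (R : realType) :
  exists N : nat, forall n : nat, (N <= n)%N ->
    let X : R := (36 / 100) * n%:R * ln n%:R / ln (ln n%:R) in
    X < (max_f n)%:R - (f n n)%:R /\
    exists x : R,
      ~ has_distinct_multiples n [set z : int | z%:~R \in `[x, x + X]].
Proof.
(* with c = 0.45 u and P = 0.003 u, the difference is at least
   (16/17) 0.45 u n - 0.01 n - 0.024 u n > 0.36 u n, where u = log n / loglog n *)
have [N N_large] := loglog_unbounded (10 ^+ 6 : R); exists N => n /N_large.
set L : R := ln n%:R; set x := ln L => x_ge.
have x_gt0 : 0 < x by apply: lt_le_trans x_ge; rewrite exprn_gt0.
have L_gt1 : 1 < L.
  by rewrite ltNge; apply: contraTN x_gt0 => /ln_le0; rewrite leNgt.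
have L_gt0 : 0 < L by apply: lt_trans L_gt1.
have n_gt1 : 1 < n%:R :> R.
  by rewrite ltNge; apply: contraTN L_gt0 => /ln_le0; rewrite leNgt.
have n_gt0 : (0 < n)%N by rewrite -(ltr0n R); apply: lt_trans n_gt1.
pose u := L / x; have ux : u * x = L by rewrite divfK ?gt_eqF.
have u_ge0 : 0 <= u by rewrite divr_ge0 // ltW.
have [l_ge l_le] := trunc_log2_bounds R n_gt0.
set l := trunc_log 2 n in l_ge l_le.
have trunc (y : R) : 0 <= y -> exists k : nat, k%:R <= y < k.+1%:R.
  by move=> y_ge0; exists (Num.truncn y); apply: truncn_itv.
have [|c c_def] := trunc (45 / 100 * u); first by clear - u_ge0; lra.
have [|P P_def] := trunc (3 / 1000 * u); first by clear - u_ge0; lra.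
have [|||||[c_gt0 n_big c_l c_n] [P_big P_l P_cube] u_ge] :=
  @parameters R x u n l c P x_ge _ _ _ _ _ c_def P_def.
- by rewrite ux lnK // posrE (lt_trans _ n_gt1).
- by rewrite ux lnK // posrE.
- by rewrite ux.
- by rewrite ux.
- exact: trunc_logP.
have [len [m [m_gt0 len_ge bad]]] := long_bad_interval c_gt0 n_big c_l c_n.
have f_nn := f_diag_small P_big P_l P_cube.
have len_lt : (len < max_f n)%N.
  by apply: leq_trans (ltn_f bad) _; apply: (max_fP n).2.
move=> X; have X_eq : X = 36 / 100 * (u * n%:R).
  by rewrite /X /u; ring.
have Pn_le : P%:R * n%:R <= 3 / 1000 * (u * n%:R).
  by rewrite mulrA ler_wpM2r //; case/andP: P_def.
have cn_ge : 45 / 100 * (u * n%:R) <= c.+1%:R * n%:R.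
  by rewrite mulrA ler_wpM2r //; case/andP: c_def => _ /ltW.
have un_ge : 1000 * n%:R <= u * n%:R by rewrite ler_wpM2r.
move: len_ge; rewrite -(ler_nat R) natrD (natrM R 1600) (natrM R c.+1).
rewrite (natrM R 1700) (natrM R 17) => len_ge.
move: f_nn; rewrite -(ler_nat R) -mulnA (natrM R 8) (natrM R P) => f_nn.
have lenR : len%:R + 1 <= (max_f n)%:R :> R by rewrite natr1 ler_nat.
rewrite X_eq; split.
  by clear - len_ge f_nn lenR Pn_le cn_ge un_ge n_gt1; lra.
exists (m%:R + 1) => mult; apply: bad.
apply: has_distinct_multiples_sub mult => z /=; rewrite !in_itv /=.
move=> /andP[z_ge z_le].
have z_gt : (m%:Z)%:~R < z%:~R :> R.
  by rewrite -pmulrn; apply: lt_le_trans z_ge; rewrite ltrDl.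
have z_len : z%:~R <= ((m + len)%N%:Z)%:~R :> R.
  rewrite -pmulrn natrD.
  by clear - len_ge lenR Pn_le cn_ge un_ge n_gt1 z_le; lra.
by rewrite -(ltr_int R) z_gt -(ler_int R).
Qed.
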